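(* Let $\mu$ be a Borel measure on $\mathbb{R}$. Then for all $a\in[-\infty,\infty)$, the following two statements are equivalent: (i) There is $t > a$ such that $\mu_{\mathrm{sf}}((a,t)) < \infty$. (ii) There is $b \in(a,\infty)$ such that for any real-valued Borel function $y$ on $\mathbb{R}$ which is $\mu$-integrable over $(a,b)$ and satisfies $$y(t) \leq \int_{(a,t)} y \,\mathrm{d} \mu \quad \text{for } \mu\text{-a.e. } t \in (a,b),$$ we have $y \leq 0$ $\mu$-a.e. on $(a,b)$.
   Context: A Borel measure on $\mathbb{R}$ is any (countably additive) measure $\mu:\mathcal{B}(\mathbb{R})\to[0,\infty]$ on the Borel $\sigma$-algebra $\mathcal{B}(\mathbb{R})$ of $\mathbb{R}$ with its standard topology; no finiteness, local finiteness, $\sigma$-finiteness or semi-finiteness is assumed. The semi-finite part of $\mu$ is the measure $\mu_{\mathrm{sf}}:\mathcal{B}(\mathbb{R})\to[0,\infty]$ given by $\mu_{\mathrm{sf}}(E)=\sup\{\mu(E\cap F): F\in\mathcal{B}(\mathbb{R}),\ \mu(F)<\infty\}$. A Borel function $y$ is $\mu$-integrable over a Borel set $A$ if $\int_A |y|\,\mathrm{d}\mu<\infty$. For $a=-\infty$, $(a,t)$ means $(-\infty,t)$. *)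

(* Defs.v *)
From HB Require Import structures.
From mathcomp Require Import all_boot all_order all_algebra.
From mathcomp Require Import all_classical all_reals all_analysis.

Set Implicit Arguments.
Unset Strict Implicit.
Unset Printing Implicit Defensive.

Import Order.TTheory GRing.Theory Num.Theory.
Import numFieldNormedType.Exports.

Local Open Scope classical_set_scope.
Local Open Scope ring_scope.

(* [measurableTypeR R] carries the sigma-algebra generated by the half-open
   intervals ]x, y]; [RGenOpens.measurableE] shows that the open intervals
   generate the same one, so it is the Borel sigma-algebra. *)
Definition semifinite_part (R : realType)
    (mu : {measure set (measurableTypeR R) -> \bar R})
    (E : set (measurableTypeR R)) : \bar R :=
  ereal_sup [set mu (E `&` F) | F in [set F | measurable F /\ (mu F < +oo)%E]].

Definition open_interval (R : realType) (a : \bar R) (t : R)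
    : set (measurableTypeR R) :=
  [set x : R | (a < x%:E < t%:E)%E].

(* Main.v *)
(* (i) => (ii): take b = t.  The set N where y > 0 on (a, b) is a countable
   increasing union of sets of finite measure, so mu N is at most the
   semi-finite part of (a, b), hence finite.  Let c be the infimum of the points
   up to which N has positive measure; the inequality shows that N is null up to
   c included.  On a short interval (c, s) with mu (N n (c, s)) < 1/2 the
   integral J of y over N up to s satisfies J <= J / 2, so N is null up to s,
   contradicting the choice of c.
   (ii) => (i): if the semi-finite part is infinite on every (a, t), there are
   points b = t_0 > t_1 > ... > a and sets F_n in [t_(n+1), t_n) with
   2 <= mu F_n < oo.  The function sum_n 2^-(n+1) / mu F_n on F_n is integrable,
   and on F_n it is at most 2^-(n+2), its integral over F_(n+1). *)

Require Import Defs.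
From HB Require Import structures.
From mathcomp Require Import all_boot all_order all_algebra.
From mathcomp Require Import all_classical all_reals all_analysis.
From mathcomp Require Import measurable_realfun ring lra.
Import Order.TTheory GRing.Theory Num.Theory.
Import numFieldNormedType.Exports.
Local Open Scope classical_set_scope.
Local Open Scope ring_scope.

(** * Points decreasing to [a] and continuity from above *)

(** Treats a real left endpoint and [-oo] at once, so that later arguments need no case split on
    [a]. *)
Lemma ereal_right_sequence {R : realType} {a : \bar R} : (a < +oo)%E ->
  exists u : nat -> R, [/\ {homo u : m n / (m <= n)%N >-> n <= m},
    forall n, (a < (u n)%:E)%E &
    forall x : R, (a < x%:E)%E -> exists n, u n < x].
Proof.
case: a => [r| |] // _.
  exists (fun n => r + n.+1%:R^-1); split.
  - by move=> m n mn; rewrite lerD2l lef_pV2 ?posrE // ler_nat ltnS.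
  - by move=> n; rewrite lte_fin ltrDl invr_gt0.
  - move=> x; rewrite lte_fin => rx.
    have xr : 0 < x - r by rewrite subr_gt0.
    exists (Num.truncn (x - r)^-1).
    rewrite -ltrBrDl invf_plt ?posrE //.
    exact: truncnS_gt.
exists (fun n => - n%:R); split.
- by move=> m n mn; rewrite lerN2 ler_nat.
- by move=> n; rewrite ltNyr.
- by move=> x _; exists (Num.truncn (- x)).+1; rewrite ltrNl truncnS_gt.
Qed.

Lemma measurable_open_interval {R : realType} (a : \bar R) (t : R) :
  measurable (open_interval a t).
Proof.
rewrite /open_interval; case: a => [r| |].
- rewrite (_ : [set x | _] = `]r, t[%classic); first exact: measurable_itv.
  by apply/seteqP; split => x /=; rewrite in_itv /= !lte_fin.
- rewrite (_ : [set x | _] = set0) //.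
  by apply/seteqP; split => x //= /andP[]; rewrite ltNge leey.
- rewrite (_ : [set x | _] = `]-oo, t[%classic); first exact: measurable_itv.
  by apply/seteqP; split => x /=; rewrite in_itv /= ltNyr lte_fin.
Qed.

(** Continuity from above: the intervals exclude [a], so they shrink to the empty set. Intersecting
    with [F] of finite measure makes up for [mu] being possibly infinite near [a]. *)
Lemma measure_open_interval_small {R : realType}
    {mu : {measure set (measurableTypeR R) -> \bar R}}
    {F : set (measurableTypeR R)} {a : \bar R} {e : R} :
  (a < +oo)%E -> measurable F -> (mu F < +oo)%E -> 0 < e ->
  exists2 s : R, (a < s%:E)%E & (mu (F `&` open_interval a s) < e%:E)%E.
Proof.
move=> ay mF Foo e0.
have [u [u_dec ua u_small]] := ereal_right_sequence ay.
pose G n := F `&` open_interval a (u n).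
have mG n : measurable (G n).
  by apply: measurableI => //; exact: measurable_open_interval.
have G0 : \bigcap_n G n = set0.
  apply/seteqP; split => // x Gx.
  have [_ /= /andP[ax _]] := Gx 0%N I.
  have [n unx] := u_small x ax.
  have [_ /= /andP[_]] := Gx n I.
  by rewrite lte_fin ltNge (ltW unx).
have : (mu \o G) x @[x --> \oo] --> mu (\bigcap_n G n).
  apply: nonincreasing_cvg_mu => //.
  - apply: le_lt_trans Foo; apply: le_measure; rewrite ?inE //.
    exact: subIsetl.
  - by rewrite G0; exact: measurable0.
  - move=> m n mn; apply/subsetPset; apply: setIS => x /andP[ax xn].
    apply/andP; split => //; apply: lt_le_trans xn _.
    by rewrite lee_fin; exact: u_dec.
rewrite G0 measure0 => /fine_cvgP[Gfin].
move=> /cvgrPdist_lt /(_ _ e0) Glt.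
have [n [nfin nlt]] : exists n, mu (G n) \is a fin_num /\
    `|0 - fine (mu (G n))| < e.
  have [n _ H] : \forall n \near \oo, mu (G n) \is a fin_num /\
    `|0 - fine (mu (G n))| < e.
    near=> n; split; near: n; [exact: Gfin|exact: Glt].
  by exists n; apply: (H n) => /=.
exists (u n) => //.
rewrite -[X in (X < _)%E]fineK // lte_fin.
by move: nlt; rewrite sub0r normrN ger0_norm // fine_ge0.
Unshelve. all: by end_near.
Qed.

(** * From (i) to (ii): the set where [y] is positive is null *)

Lemma gronwall_null {R : realType}
    {mu : {measure set (measurableTypeR R) -> \bar R}}
    {N : set (measurableTypeR R)} {b : R} {y : measurableTypeR R -> R} :
  measurable N -> (mu N < +oo)%E -> N `<=` [set x : R | x < b] ->
  measurable_fun setT y -> (forall x, N x -> 0 < y x) ->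
  (\int[mu]_(x in N) (y x)%:E < +oo)%E ->
  {ae mu, forall t, N t ->
    ((y t)%:E <= \int[mu]_(x in N `&` [set x : R | (x < t)%R]) (y x)%:E)%E} ->
  mu N = 0.
Proof.
move=> mN Noo Nb my y_gt0 yoo [B [mB muB0 NB]].
pose L (t : R) : set (measurableTypeR R) := N `&` [set x : R | x < t].
have mL t : measurable (L t).
  apply: measurableI => //.
  rewrite (_ : [set x | _] = `]-oo, t[%classic); first exact: measurable_itv.
  by apply/seteqP; split => x /=; rewrite in_itv.
have myE D : measurable_fun D (EFin \o y).
  by apply/measurable_EFinP; exact: measurable_funS my.
have LN t : L t `<=` N by exact: subIsetl.
have Ly t x : L t x -> (0 <= (y x)%:E)%E.
  by move=> /LN/y_gt0/ltW; rewrite lee_fin.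
(* Where the integral is at most 0, positivity of [y] violates the inequality, so [K] lies in the
   exceptional set [B]. *)
have null K : measurable K -> K `<=` N ->
    (forall x, K x -> (\int[mu]_(z in L x) (y z)%:E <= 0)%E) -> mu K = 0.
  move=> mK KN K0; apply: (subset_measure0 mK mB) => // x Kx.
  apply: NB => /= /(_ (KN _ Kx)); apply/negP; rewrite -ltNge.
  by apply: le_lt_trans (K0 _ Kx) _; rewrite lte_fin; exact: y_gt0 (KN _ Kx).
apply: contrapT => /eqP N0.
(* The infimum is taken in the extended reals: [N] may have positive measure below every real, and
   then [c] is [-oo]. *)
pose A := [set s%:E | s in [set s : R | mu (L s) != 0]].
pose c := ereal_inf A.
have Ab : A b%:E.
  exists b => //=; rewrite (_ : L b = N) //; apply/seteqP; split => // x Nx.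
  by split => //; exact: Nb.
have cb : (c <= b%:E)%E by exact: ereal_inf_lbound.
have coo : (c < +oo)%E by apply: le_lt_trans cb _; exact: ltry.
have Lc (s : R) : (s%:E < c)%E -> mu (L s) = 0.
  move=> sc; apply: contrapT => /eqP Ls0.
  by move: sc; rewrite ltNge => /negP; apply; apply: ereal_inf_lbound; exists s.
have Llec (x : R) : (x%:E <= c)%E -> mu (L x) = 0.
  move=> xc.
  (* By reflection, the points [- u n] approach [x] strictly from below. They are thus below [c]
     even when [x] equals [c]. *)
  have [u [_ ux u_small]] := ereal_right_sequence (ltry (- x)).
  have LU : L x `<=` \bigcup_n L (- u n).
    move=> z [Nz /= zx].
    have xz : ((- x)%:E < (- z)%:E)%E by rewrite lte_fin ltrN2.
    have [n unz] := u_small _ xz.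
    by exists n => //; split => //=; rewrite ltrNr.
  apply/(negligibleP _ (mL x)); apply: negligibleS LU _.
  apply: negligible_bigcup => n; apply/(negligibleP _ (mL _)); apply: Lc.
  by apply: lt_le_trans xc; rewrite lte_fin ltrNl -lte_fin.
(* The atom c, if real, is covered too: its inequality only involves the
   integral over the points strictly before it. *)
pose E : set (measurableTypeR R) := N `&` [set x : R | (x%:E <= c)%E].
have mE : measurable E.
  apply: measurableI => //; case: (c) => [r| |].
  - rewrite (_ : [set x | _] = `]-oo, r]%classic); first exact: measurable_itv.
    by apply/seteqP; split => x /=; rewrite in_itv /= lee_fin.
  - rewrite (_ : [set x | _] = setT) //.
    by apply/seteqP; split => x //= _; exact: leey.
  - rewrite (_ : [set x | _] = set0) //.
    by apply/seteqP; split => x //=; rewrite leNgt ltNyr.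
have E0 : mu E = 0.
  apply: null => //; first exact: subIsetl.
  move=> x [Nx /= xc].
  by rewrite null_set_integral // Llec.
have half0 : (0 : R) < 2^-1 by rewrite invr_gt0.
have [s cs cs_small] := measure_open_interval_small coo mN Noo half0.
have Ls_split : L s = (N `&` open_interval c s) `|` E.
  apply/seteqP; split => x /=.
    move=> [Nx /= xs]; rewrite /E /open_interval /=.
    by case: (leP x%:E c) => [xc|cx]; [right|left; split => //; rewrite lte_fin xs].
  move=> [[Nx /= /andP[_ xs]]|[Nx /= xc]]; split => //=.
  by rewrite -lte_fin; exact: le_lt_trans xc cs.
have mI : measurable (N `&` open_interval c s).
  by apply: measurableI => //; exact: measurable_open_interval.
pose J := (\int[mu]_(x in L s) (y x)%:E)%E.
have J_ge0 : (0 <= J)%E by apply: integral_ge0 => x; exact: Ly.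
have J_mono x : L s x -> (\int[mu]_(z in L x) (y z)%:E <= J)%E.
  move=> [_ /= xs]; apply: ge0_subset_integral => //; first exact: Ly.
  by move=> z [Nz /= zx]; split => //=; exact: lt_trans zx xs.
have Joo : (J < +oo)%E.
  apply: le_lt_trans yoo; apply: ge0_subset_integral => //.
  by move=> x /y_gt0/ltW; rewrite lee_fin.
(* On [L s] almost every value of [y] is at most [J], hence [J] is at most [J] times [mu (L s)],
   which is at most 1/2 because [E] is null. *)
have J_half : (J <= J * 2^-1%:E)%E.
  apply: (@le_trans _ _ (\int[mu]_(x in L s) cst J x)%E).
    apply: ae_ge0_le_integral => //.
    - exact: Ly.
    - exists B; split => // x /= xB; apply: NB => /= Nxy; apply: xB => Lx.
      by apply: le_trans (J_mono _ Lx); apply: Nxy; exact: LN Lx.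
  rewrite integral_cst //; apply: lee_wpmul2l => //.
  rewrite Ls_split; apply: le_trans (ltW cs_small).
  by rewrite -[leRHS]adde0 -E0; exact: measureU2.
(* Finiteness of [J] is essential here: [+oo] also satisfies the halving inequality. *)
have J0 : (J <= 0)%E.
  move: J_ge0 Joo J_half; case: (J) => [r| |] //; rewrite !lee_fin => r0 _.
  by lra.
have Ls0 : mu (L s) = 0.
  by apply: null => // x Lx; exact: le_trans (J_mono _ Lx) J0.
suff : (s%:E <= c)%E by rewrite leNgt cs.
apply/ereal_infP => _ [r /= Lr <-]; rewrite lee_fin leNgt; apply/negP => rs.
move: Lr => /eqP; apply; apply: (subset_measure0 (mL r) (mL s)) => //.
by move=> x [Nx /= xr]; split => //=; exact: lt_trans xr rs.
Qed.

(** By Chebyshev's inequality each level set [G n] has finite measure, so it competes in the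
    supremum; continuity from below passes to their union. *)
Lemma measure_pos_set_le {R : realType}
    {mu : {measure set (measurableTypeR R) -> \bar R}}
    {D : set (measurableTypeR R)} {y : measurableTypeR R -> R} :
  measurable D -> measurable_fun setT y -> mu.-integrable D (EFin \o y) ->
  (mu (D `&` [set x | (0 < y x)%R]) <= semifinite_part mu D)%E.
Proof.
move=> mD my /integrableP[_ yoo].
have mge r : measurable [set x | (r <= y x)%R].
  rewrite -[X in measurable X]setTI (_ : [set x | _] = y @^-1` `[r, +oo[).
    by apply: my => //; exact: measurable_itv.
  by apply/seteqP; split => x /=; rewrite in_itv /= andbT.
have myE E : measurable_fun E (EFin \o y).
  by apply/measurable_EFinP; exact: measurable_funS my.
pose G n := D `&` [set x | (n.+1%:R^-1 <= y x)%R].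
have mG n : measurable (G n) by exact: measurableI.
have Goo n : (mu (G n) < +oo)%E.
  have : ((n.+1%:R^-1)%:E * mu (G n) <= \int[mu]_(x in D) `|(y x)%:E|)%E.
    rewrite -integral_cst //.
    apply: (@le_trans _ _ (\int[mu]_(x in G n) `|(y x)%:E|)%E).
      apply: ge0_le_integral => //.
      - by move=> x _; rewrite lee_fin.
      - exact: measurableT_comp (@abse_measurable _ _) (myE _).
      - by move=> x [_ /= /le_trans]; apply; exact: ler_norm.
    apply: ge0_subset_integral => //; last exact: subIsetl.
    exact: measurableT_comp (@abse_measurable _ _) (myE _).
  move=> /le_lt_trans/(_ yoo).
  case: (mu (G n)) => [r| |] //; first by move=> _; exact: ltry.
  by rewrite gt0_muley ?ltxx // lte_fin invr_gt0.
have GU : D `&` [set x | (0 < y x)%R] = \bigcup_n G n.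
  apply/seteqP; split => x.
    move=> [Dx /= yx]; exists (Num.truncn (y x)^-1) => //; split => //=.
    by rewrite invf_ple ?posrE // ltW // truncnS_gt.
  move=> [n _ [Dx /= nyx]]; split => //=.
  by apply: lt_le_trans nyx; rewrite invr_gt0.
have : (mu \o G) x @[x --> \oo] --> mu (\bigcup_n G n).
  apply: nondecreasing_cvg_mu => //; first exact: bigcup_measurable.
  move=> m n mn; apply/subsetPset; apply: setIS => x /=.
  by apply: le_trans; rewrite lef_pV2 ?posrE // ler_nat ltnS.
rewrite GU => Gcvg; rewrite -(cvg_lim _ Gcvg) //.
apply: lime_le; first by apply/cvg_ex; exists (mu (\bigcup_n G n)).
apply: nearW => n /=; apply: ereal_sup_ubound; exists (G n) => //.
by rewrite setIA setIid.
Qed.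

(** Dropping the points where [y] is not positive only increases the integral, so the inequality
    survives on the positivity set, whose measure is finite. *)
Lemma integral_ineq_nonpos {R : realType}
    {mu : {measure set (measurableTypeR R) -> \bar R}} {a : \bar R} {b : R}
    {y : measurableTypeR R -> R} :
  (semifinite_part mu (open_interval a b) < +oo)%E ->
  measurable_fun setT y ->
  mu.-integrable (open_interval a b) (EFin \o y) ->
  {ae mu, forall t, open_interval a b t ->
    ((y t)%:E <= \int[mu]_(x in open_interval a t) (y x)%:E)%E} ->
  {ae mu, forall t, open_interval a b t -> y t <= 0}.
Proof.
move=> sfoo my yint yle.
pose D := open_interval a b.
pose P : set (measurableTypeR R) := [set x | (0 < y x)%R].
have mD : measurable D by exact: measurable_open_interval.
have mP : measurable P.
  rewrite -[P]setTI (_ : P = y @^-1` `]0, +oo[).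
    by apply: my => //; exact: measurable_itv.
  by apply/seteqP; split => x /=; rewrite in_itv /= andbT.
have mDP : measurable (D `&` P) by exact: measurableI.
exists (D `&` P); split => //; last first.
  move=> t /= /not_implyP[Dt /negP]; rewrite -ltNge => yt.
  by split.
apply: (gronwall_null (b := b) (y := y)) => //.
- exact: le_lt_trans (measure_pos_set_le mD my yint) sfoo.
- by move=> x [/andP[_]]; rewrite lte_fin.
- by move=> x [].
- have /integrableP[_] := integrableS mD mDP (@subIsetl _ _ _) yint.
  apply: le_lt_trans; apply: ge0_le_integral => //.
  + by move=> x [_ /ltW]; rewrite lee_fin.
  + by apply/measurable_EFinP; exact: measurable_funS my.
  + apply: measurableT_comp (@abse_measurable _ _) _.
    by apply/measurable_EFinP; exact: measurable_funS my.
  + by move=> x _; rewrite lee_fin ler_norm.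
apply: filterS yle => t yt [Dt Pt].
apply: le_trans (yt Dt) _.
have mI : measurable (open_interval a t) by exact: measurable_open_interval.
have ID : open_interval a t `<=` D.
  move=> x /andP[ax xt]; apply/andP; split => //.
  by move: Dt => /andP[_]; exact: lt_trans.
have -> : D `&` P `&` [set x : R | x < t] = open_interval a t `&` P.
  apply/seteqP; split => x.
    move=> [[/andP[ax _] Px] /= xt]; split => //; apply/andP; split => //.
  move=> [Ix Px]; split; first by split => //; exact: ID.
  by move: Ix => /andP[_]; rewrite lte_fin.
(* Pointwise comparison: off [P] the restricted integrand is 0, while [y] is at most 0. *)
rewrite integral_mkcondr; apply: le_integral => //.
- exact: integrableS yint.
- apply: le_integrable (integrableS mD mI ID yint) => //.
  + apply/(measurable_restrict (EFin \o y) mP mI).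
    by apply/measurable_EFinP; exact: measurable_funS my.
  + by move=> x _; rewrite patchE; case: ifPn => //= _; rewrite normr0 lee_fin.
move=> x _; rewrite patchE; case: ifPn => //; rewrite notin_setE /= => /negP.
by rewrite -leNgt lee_fin.
Qed.

(** * From (ii) to (i): construction of a counterexample *)

(** A set of finite measure above 3 loses less than 1 when cut near [a]; what remains has measure at
    least 2 and lies to the right of some [s > a], so the step can be repeated below [s]. *)
Lemma semifinite_infty_step {R : realType}
    {mu : {measure set (measurableTypeR R) -> \bar R}} {a : \bar R} {t : R} :
  (a < +oo)%E -> semifinite_part mu (open_interval a t) = +oo%E ->
  exists s : R, exists F : set (measurableTypeR R),
    [/\ (a < s%:E)%E, measurable F,
        F `<=` [set x : R | s <= x < t], (2%:E <= mu F)%E & (mu F < +oo)%E].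
Proof.
move=> ay sfoo.
have : (3%:E < semifinite_part mu (open_interval a t))%E by rewrite sfoo ltry.
move=> /ereal_sup_gt[_ [F [mF Foo] <-] F3].
pose I := open_interval a t `&` F.
have mI : measurable I.
  by apply: measurableI => //; exact: measurable_open_interval.
have Ioo : (mu I < +oo)%E.
  by apply: le_lt_trans Foo; apply: le_measure; rewrite ?inE //; exact: subIsetr.
have [s as_ s_small] := measure_open_interval_small ay mI Ioo ltr01.
have mIs : measurable (I `&` open_interval a s).
  by apply: measurableI => //; exact: measurable_open_interval.
have mID : measurable (I `\` open_interval a s).
  by apply: measurableD => //; exact: measurable_open_interval.
exists s, (I `\` open_interval a s); split => //.
- move=> x [[/andP[ax xt] _] /negP]; rewrite negb_and ax /= -leNgt lee_fin => sx.
  by rewrite sx -lte_fin.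
- rewrite leNgt; apply/negP => ID2; move: F3; apply/negP; rewrite -leNgt.
  have := measureU2 mu mIs mID; rewrite setUIDK => /le_trans; apply.
  have -> : (3%:E = 1%:E + 2%:E :> \bar R)%E by rewrite -EFinD; congr EFin; lra.
  by apply: leeD; exact: ltW.
- apply: le_lt_trans Ioo; apply: le_measure; rewrite ?inE //; exact: subDsetl.
Qed.

Lemma exists_counterexample {R : realType}
    {mu : {measure set (measurableTypeR R) -> \bar R}} {a : \bar R}
    {t : nat -> R} {F : nat -> set (measurableTypeR R)} :
  (forall n, a < (t n)%:E)%E -> (forall n, measurable (F n)) ->
  (forall n, F n `<=` [set x : R | t n.+1 <= x < t n]) ->
  (forall n, 2%:E <= mu (F n))%E -> (forall n, mu (F n) < +oo)%E ->
  exists y : measurableTypeR R -> R,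
    [/\ measurable_fun setT y,
        mu.-integrable (open_interval a (t 0%N)) (EFin \o y),
        forall s, open_interval a (t 0%N) s ->
          ((y s)%:E <= \int[mu]_(x in open_interval a s) (y x)%:E)%E &
        forall x, F 0%N x -> 0 < y x].
Proof.
move=> at_ mF Ft F2 Foo.
(* Each [F n] has positive measure, hence contains a point, which separates [t n.+1] from [t n]. *)
have t_dec : {homo t : m n / (m <= n)%N >-> n <= m}.
  apply/nonincreasing_seqP => n.
  have [x /Ft /andP[tx xt]] : F n !=set0.
    apply/set0P; apply/eqP => Fn0; have := F2 n.
    by rewrite Fn0 measure0 lee_fin; lra.
  exact: le_trans tx (ltW xt).
have F_disj m n x : F m x -> F n x -> m = n.
  have lt_false i j : (i < j)%N -> F i x -> F j x -> False.
    move=> ij /Ft /andP[tx _] /Ft /andP[_ xt].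
    by have := lt_le_trans xt (t_dec _ _ ij); rewrite ltNge tx.
  move=> Fm Fn; case: (ltngtP m n) => // mn; exfalso.
  - exact: lt_false mn Fm Fn.
  - exact: lt_false mn Fn Fm.
pose q n := fine (mu (F n)).
have qE n : (q n)%:E = mu (F n).
  by rewrite fineK // ge0_fin_numE.
have q2 n : 2 <= q n by rewrite -lee_fin qE.
have q0 n : 0 < q n by apply: lt_le_trans (q2 n).
(* With this weight [F n] contributes [1 / 2 ^ n.+1] to the integral, a summable amount. *)
pose c n := (1 / (2 ^ n.+1)%:R) / q n : R.
have c0 n : 0 < c n by rewrite divr_gt0 // divr_gt0 // ltr0n expn_gt0.
have cq n : c n * q n = 1 / (2 ^ n.+1)%:R.
  by rewrite /c divfK // gt_eqF.
(* This is where the bound 2 on the measures enters: it absorbs the factor lost between consecutive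
   powers of 1/2. *)
have c_next n : c n <= c n.+1 * q n.+1.
  rewrite cq /c ler_pdivrMr //.
  have -> : (1 / (2 ^ n.+1)%:R : R) = 1 / (2 ^ n.+2)%:R * 2.
    by rewrite (expnS 2 n.+1) natrM; field; rewrite pnatr_eq0 expn_eq0.
  by apply: ler_wpM2l => //; rewrite divr_ge0.
pose f n (x : measurableTypeR R) : \bar R := ((c n) * \1_(F n) x)%:E.
have f0 n x : (0 <= f n x)%E by rewrite lee_fin mulr_ge0 // ltW.
have mf D n : measurable_fun D (f n).
  apply/measurable_EFinP; exact: measurable_funM.
pose Y x := (\sum_(0 <= n <oo) f n x)%E.
have Y_in n x : F n x -> Y x = (c n)%:E.
  move=> Fx; rewrite /Y (nneseriesD1 (n := n)) // eseries0 ?adde0.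
    by rewrite /f indicE mem_set // mulr1.
  move=> k _ /= kn; rewrite /f indicE memNset ?mulr0 // => Fk.
  by move/eqP: kn; apply; exact: F_disj Fk Fx.
have Y_out x : (forall n, ~ F n x) -> Y x = 0%E.
  by move=> nF; rewrite /Y eseries0 // => k _ _; rewrite /f indicE memNset ?mulr0.
have Y_fin x : (fine (Y x))%:E = Y x.
  have [[n Fn]|/forallNP nF] := pselect (exists n, F n x).
    by rewrite (Y_in n).
  by rewrite Y_out.
have Y0 x : (0 <= Y x)%E by exact: nneseries_ge0.
have mY D : measurable_fun D Y.
  exact: ge0_emeasurable_sum.
have YE : EFin \o (fine \o Y) = Y by apply/funext => x /=; exact: Y_fin.
exists (fine \o Y); split.
- exact: measurableT_comp (fine_measurable _) (mY setT).
- have mD : measurable (open_interval a (t 0%N)) by exact: measurable_open_interval.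
  rewrite YE; apply/integrableP; split => //.
  under eq_integral do rewrite gee0_abs //.
  rewrite integral_nneseries //.
  apply: (@le_lt_trans _ _ 1%:E); last exact: ltry.
  apply: le_trans (epsilon_trick0 xpredT ler01).
  apply: lee_nneseries => [n _ _|n _]; first by apply: integral_ge0.
  rewrite -cq EFinM qE /f.
  under eq_integral do rewrite EFinM.
  rewrite ge0_integralZl_EFin //; last 2 first.
    + by apply/measurable_EFinP; exact: measurable_indic.
    + exact: ltW.
  rewrite integral_indic //; apply: lee_wpmul2l; first by rewrite lee_fin ltW.
  by apply: le_measure; rewrite ?inE //; exact: measurableI.
- move=> s _.
  under eq_integral do rewrite Y_fin.
  rewrite /= Y_fin.
  have mD : measurable (open_interval a s) by exact: measurable_open_interval.
  have [[n Fn]|/forallNP nF] := pselect (exists n, F n s); last first.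
    by rewrite Y_out //; exact: integral_ge0.
  (* All of [F n.+1] lies strictly below [t n.+1], and [s] in [F n] is at least [t n.+1]. *)
  have FS : F n.+1 `<=` open_interval a s.
    move=> x /Ft /andP[tx xt]; apply/andP; split.
      by apply: lt_le_trans (at_ n.+2) _; rewrite lee_fin.
    by rewrite lte_fin; apply: lt_le_trans xt _; case/andP: (Ft _ _ Fn).
  rewrite (Y_in n) //.
  apply: (@le_trans _ _ (\int[mu]_(x in F n.+1) Y x)%E); last first.
    exact: ge0_subset_integral.
  rewrite (eq_integral (cst (c n.+1)%:E)); last first.
    by move=> x /set_mem Fx; rewrite (Y_in n.+1).
  by rewrite integral_cst // -qE -EFinM lee_fin.
- by move=> x Fx /=; rewrite (Y_in 0%N) //=.
Qed.

Theorem theorem2p3 (R : realType)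
    (mu : {measure set (measurableTypeR R) -> \bar R})
    (a : \bar R) (ha : (a < +oo)%E) :
  (exists t : R, (a < t%:E)%E /\
     (semifinite_part mu (open_interval a t) < +oo)%E)
  <->
  (exists b : R, (a < b%:E)%E /\
     forall y : measurableTypeR R -> R,
       measurable_fun setT y ->
       mu.-integrable (open_interval a b) (fun x => (y x)%:E) ->
       {ae mu, forall t, open_interval a b t ->
          ((y t)%:E <= \int[mu]_(x in open_interval a t) (y x)%:E)%E} ->
       {ae mu, forall t, open_interval a b t -> y t <= 0}).
Proof.
split=> [[t [at_ sfoo]]|[b [ab Hb]]].
  by exists t; split => // y; exact: integral_ineq_nonpos.
apply: contrapT => /forallNP no_t.
(* The premise [a < t] sits under the existential so that choice yields a total function;
   [(0, set0)] is a dummy value for other [t]. *)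
have /choice[g gP] (t : R) : exists p : R * set (measurableTypeR R),
    (a < t%:E)%E -> [/\ (a < p.1%:E)%E, measurable p.2,
      p.2 `<=` [set x : R | p.1 <= x < t], (2%:E <= mu p.2)%E &
      (mu p.2 < +oo)%E].
  have [at_|] := boolP (a < t%:E)%E; last by exists (0, set0).
  have sfoo : semifinite_part mu (open_interval a t) = +oo%E.
    apply/eqP; rewrite eq_le leey /= leNgt; apply/negP => lt.
    by apply: (no_t t); split.
  have [s [F ?]] := semifinite_infty_step ha sfoo.
  by exists (s, F).
pose t := fix t n := if n is m.+1 then (g (t m)).1 else b.
have at_ n : (a < (t n)%:E)%E by elim: n => [|n IH] //=; have [] := gP _ IH.
have gt n := gP _ (at_ n).
have [y [my iy ley ypos]] := exists_counterexample (t := t)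
  (F := fun n => (g (t n)).2) at_ (fun n => let: And5 _ h _ _ _ := gt n in h)
  (fun n => let: And5 _ _ h _ _ := gt n in h)
  (fun n => let: And5 _ _ _ h _ := gt n in h)
  (fun n => let: And5 _ _ _ _ h := gt n in h).
have [B [mB B0 yB]] := Hb y my iy (aeW mu ley).
have [_ mG Gsub G2 _] := gt 0%N.
(* The set [F 0] lies in the interval, and [y] is positive on it, so the conclusion of (ii) makes it
   null, against measure at least 2. *)
have G0 : mu (g b).2 = 0.
  apply: (subset_measure0 mG mB) => // x Gx; apply: yB => /= yx.
  have : y x <= 0.
    apply: yx; apply/andP; have /andP[tx xt] := Gsub _ Gx; split => //.
    by apply: lt_le_trans (at_ 1%N) _; rewrite lee_fin.
  by rewrite leNgt ypos.
by move: G2; rewrite /= G0 lee_fin; lra.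
Qed.
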